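(* Let $N\in\mathbb{N}$ be sufficiently large and $k=\frac{10}{216}\cdot\frac{N}{\ln N}$ (rounded to an integer). Then there exists a blue/red coloring of $Q=\mathcal{Q}([N])$ which contains no blue copy of $\Lambda$ and such that for each $\mathcal{Y}\in\binom{[N]}{k}$ there is a blue $\mathcal{Y}$-shrub in $Q$.
   Context: $[N]=\{1,\dots,N\}$; $\binom{[N]}{k}$ is the set of $k$-element subsets; $\ln$ is the natural logarithm. $\mathcal{Q}([N])$ is the Boolean lattice of all subsets of $[N]$ ordered by inclusion. $\Lambda$ is the poset on $Z_1,Z_2,Z_3$ with $Z_1<Z_3$, $Z_2<Z_3$, $Z_1,Z_2$ incomparable; a blue copy is a set of blue elements isomorphic to $\Lambda$ under inclusion. An ordered subset of $\mathcal{Y}$ is a (possibly empty) subset with a linear order; $\underline{S}$ is its underlying set; $T\le_{\mathcal{O}}S$ means $T$ is a prefix of $S$. The factorial tree $\mathcal{O}(\mathcal{Y})$ is the poset of ordered subsets of $\mathcal{Y}$ under $\le_{\mathcal{O}}$. A $\mathcal{Y}$-shrub in $Q$ is the image of a poset embedding (injective, $S\le_{\mathcal{O}}T$ iff $\tau(S)\subseteq\tau(T)$) $\tau:\mathcal{O}(\mathcal{Y})\to Q$ with $\tau(S)\cap\mathcal{Y}=\underline{S}$ for all $S$; it is blue if all its elements are blue. *)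

(* Defs.v *)
From mathcomp Require Import all_boot all_order all_algebra.
From mathcomp Require Import reals.

Set Implicit Arguments.
Unset Strict Implicit.
Unset Printing Implicit Defensive.

(* The ground set [N] is 'I_N (labels 0, ..., N-1 instead of 1, ..., N), and
   the Boolean lattice Q([N]) is {set 'I_N} ordered by \subset. *)

Inductive color := Blue | Red.

(* The integers at distance less than 1 from x are its floor and its ceiling,
   so "rounded to an integer" covers rounding down, up and to the nearest. *)
Definition is_rounding (R : realType) (x : R) (k : nat) : Prop :=
  (`|k%:R - x| < 1)%R.

Section BooleanLattice.
Variable T : finType.

Definition poset_embedding (P : Type) (le : rel P) (f : P -> {set T}) : Prop :=
  injective f /\ {mono f : a b / le a b >-> a \subset b}.

Definition is_image (P : Type) (f : P -> {set T}) (F : {set {set T}}) : Prop :=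
  forall A : {set T}, A \in F <-> exists p : P, f p = A.

Definition all_blue (c : {set T} -> color) (F : {set {set T}}) : Prop :=
  forall A : {set T}, A \in F -> c A = Blue.

(* Z_1, Z_2, Z_3 are encoded as 0, 1, 2 : 'I_3. *)
Definition Lambda_le : rel 'I_3 :=
  fun a b => (a == b) || (b == ord_max).

Definition Lambda_copy (F : {set {set T}}) : Prop :=
  exists f : 'I_3 -> {set T}, poset_embedding Lambda_le f /\ is_image f F.

(* A linearly ordered subset of Y is the duplicate-free list of its elements
   in increasing order. *)
Definition ordered_subset (Y : {set T}) : pred (seq T) :=
  fun s => uniq s && all [in Y] s.

Definition factorial_tree (Y : {set T}) : Type :=
  {s : seq T | ordered_subset Y s}.

Definition prefix_le (Y : {set T}) : rel (factorial_tree Y) :=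
  fun S S' => prefix (sval S) (sval S').

Definition underlying (Y : {set T}) (S : factorial_tree Y) : {set T} :=
  [set x in sval S].

Definition shrub (Y : {set T}) (F : {set {set T}}) : Prop :=
  exists tau : factorial_tree Y -> {set T},
    [/\ poset_embedding (@prefix_le Y) tau,
        forall S : factorial_tree Y, tau S :&: Y = underlying S
      & is_image tau F].

End BooleanLattice.

(* Main.v *)
Require Import Defs.
From mathcomp Require Import all_boot all_order all_algebra all_field.
From mathcomp Require Import boolp reals exp.
From mathcomp Require Import zify lra.

(* Fix 2^r >= N and assign to each k-set Y the polynomial prod_{y in Y} (X - y)
   over GF(2^r); two of these agree at no more than k of 3k+1 fixed evaluation
   points. Write each value in 2r ground elements, one per pair (bit position,
   bit), so that distinct values become incomparable sets. The resulting code
   words lie in a fixed area A and keep a difference in both directions even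
   after Y and Y' are deleted; hence putting the code word of Y (minus Y) in
   every vertex of the shrub of Y, and nothing else of A outside Y, makes
   shrubs of different k-sets elementwise incomparable. Within the shrub of Y,
   the i-th entry of an ordered subset is written in the i-th of k blocks of 2r
   elements outside A and Y, so inclusion is exactly the prefix order. All this
   needs about 8 k log_2 N <= N elements. Colouring the shrubs blue, all blue
   sets below a given one come from prefixes of a single sequence and so form a
   chain: there is no blue Lambda. *)

Set Implicit Arguments.
Unset Strict Implicit.
Unset Printing Implicit Defensive.
Import Order.TTheory GRing.Theory Num.Theory.

(** * Codes of [k]-sets that survive the deletion of [2 * k] elements *)

Lemma inj_into_set (T U : finType) (A : {set U}) :
  #|T| <= #|A| -> exists2 f : T -> U, injective f & forall x, f x \in A.
Proof.
move=> leTA; exists (fun x => enum_val (widen_ord leTA (enum_rank x))).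
  by move=> x y /enum_val_inj/(congr1 val) /= /ord_inj/enum_rank_inj.
by move=> x; apply: enum_valP.
Qed.

(** [E a] is the graph of a bit string assigned injectively to [a], and a function graph contained
    in another one equals it. *)
Lemma antichain_code (T : finType) r : #|T| <= 2 ^ r ->
  exists E : T -> {set 'I_r * bool}, forall a b, E a \subset E b -> a = b.
Proof.
move=> leT; have [|f f_inj _] := @inj_into_set T {ffun 'I_r -> bool} setT.
  by rewrite cardsT card_ffun card_bool card_ord.
exists (fun a => [set u | f a u.1 == u.2]) => a b /subsetP sab.
apply/f_inj/ffunP => i; have := sab (i, f a i).
by rewrite !inE /= eqxx => /(_ isT)/eqP.
Qed.

Lemma poly_eval_agree (F : idomainType) (n k : nat) (pt : 'I_n -> F)
    (p q : {poly F}) :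
  injective pt -> p != q -> size p <= k.+1 -> size q <= k.+1 ->
  #|[set i | p.[pt i]%R == q.[pt i]%R]| <= k.
Proof.
move=> pt_inj neq_pq sp sq; set A := [set i | _].
have nz : (p - q)%R != 0%R by rewrite subr_eq0.
have /(max_poly_roots nz) : all (root (p - q)%R) [seq pt i | i <- enum A].
  apply/allP => z /mapP[i]; rewrite mem_enum inE => /eqP eq_pq ->.
  by rewrite rootE hornerD hornerN eq_pq subrr.
rewrite map_inj_uniq // enum_uniq size_map -cardE => /(_ isT) ltA.
rewrite -ltnS (leq_trans ltA) // (leq_trans (size_polyD _ _)) //.
by rewrite size_polyN geq_max sp.
Qed.

Lemma subset_code (T : finType) (k r : nat) : #|T| <= 2 ^ r -> 0 < r ->
  3 * k < 2 ^ r ->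
  exists e : {set T} -> 'I_(3 * k).+1 -> {set 'I_r * bool},
    forall Y Y' : {set T}, #|Y| = k -> #|Y'| = k -> Y != Y' ->
      2 * k < #|[set j | ~~ (e Y j \subset e Y' j)]|.
Proof.
move=> leT r_gt0 lek.
have [F _ cardF] := pPrimePowerField (isT : prime 2) r_gt0.
have [|E E_inj] := @antichain_code F r; first by rewrite cardF.
have [|i i_inj _] := @inj_into_set T F setT; first by rewrite cardsT cardF.
(* The field has [2 ^ r > 3 * k] elements, enough for distinct evaluation points. *)
have [|pt pt_inj _] := @inj_into_set 'I_(3 * k).+1 F setT.
  by rewrite cardsT cardF card_ord.
pose p (Y : {set T}) := (\prod_(z <- [seq i y | y <- enum Y]) ('X - z%:P))%R.
exists (fun Y j => E (p Y).[pt j]%R) => Y Y' cY cY' neqY.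
have size_p (Z : {set T}) : #|Z| = k -> size (p Z) <= k.+1.
  by move=> cZ; rewrite /p size_prod_XsubC size_map -cardE cZ.
have root_p (Z : {set T}) y : root (p Z) (i y) = (y \in Z).
  by rewrite /p root_prod_XsubC mem_map // mem_enum.
(* The roots of [p Y] among the labels [i y] recover [Y]. *)
have neq_p : p Y != p Y'.
  by apply: contra_neq neqY => eq_p; apply/setP => y; rewrite -!root_p eq_p.
have := poly_eval_agree pt_inj neq_p (size_p _ cY) (size_p _ cY').
set A := [set j | _]; set D := [set j | _] => leA.
have : ~: A \subset D.
  by apply/subsetP => j; rewrite !inE; apply: contra => /E_inj ->.
move/subset_leq_card; have := cardsC A; rewrite card_ord; lia.
Qed.

(* Deleting Y and Y' from the code area destroys at most 2k of its elements,
   so the code words of Y and Y' still differ there. *)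
Lemma subset_code_in (T : finType) (k r : nat) (A : {set T}) :
  #|T| <= 2 ^ r -> 0 < r -> 3 * k < 2 ^ r -> (3 * k).+1 * (2 * r) <= #|A| ->
  exists f : {set T} -> {set T},
    (forall Y, f Y \subset A) /\
    forall Y Y' : {set T}, #|Y| = k -> #|Y'| = k -> Y != Y' ->
      ~~ (f Y \subset f Y' :|: Y :|: Y').
Proof.
move=> leT r_gt0 lek leA; have [e eP] := subset_code leT r_gt0 lek.
have [|h h_inj hA] := @inj_into_set ('I_(3 * k).+1 * ('I_r * bool))%type T A.
  by rewrite !card_prod !card_ord card_bool [r * 2]mulnC.
exists (fun Y => h @: [set z | z.2 \in e Y z.1]); split.
  by move=> Y; apply/subsetP => _ /imsetP[z _ ->].
move=> Y Y' cY cY' neqY; apply/negP => /subsetP sub.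
have := eP _ _ cY cY' neqY; set D := [set j | _]; apply/negP; rewrite -leqNgt.
(* Each [j] in [D] supplies an element of the code word of [Y] missing from that of [Y'], hence
   lying in [Y :|: Y']. These are distinct for distinct [j], so [D] has at most [2 * k] elements.
   Off [D] the choice is arbitrary. *)
have u_ex (j : 'I_(3 * k).+1) : exists u, j \in D -> (u \in e Y j) && (u \notin e Y' j).
  case: (boolP (j \in D)) => [|_]; last by exists (Ordinal r_gt0, true).
  by rewrite inE => /subsetPn[u uY uY']; exists u; rewrite uY uY'.
have [u uP] := fin_all_exists u_ex.
have hu_inj : injective (fun j => h (j, u j)) by move=> j j' /h_inj[].
have -> : 2 * k = #|Y| + #|Y'| by rewrite cY cY' addnn mul2n.
rewrite -(card_imset _ hu_inj).
apply: leq_trans (leq_card_setU Y Y'); apply/subset_leq_card/subsetP => x.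
case/imsetP=> j jD ->; have /andP[uY uY'] := uP j jD.
have := sub (h (j, u j)); rewrite imset_f ?inE // => /(_ isT).
rewrite -orbA => /orP[/imsetP[z]|//].
by rewrite inE => zY' /h_inj zE; rewrite -zE (negPf uY') in zY'.
Qed.

(** * The shrub of a single set *)

Lemma prefix_of_onth (T : eqType) (s t : seq T) :
  (forall i x, onth s i = Some x -> onth t i = Some x) -> prefix s t.
Proof.
elim: s t => [|x s IHs] [|y t] st //; first by have := st 0 x erefl.
have [->] := st 0 x erefl; rewrite prefix_cons eqxx IHs // => i.
exact: (st i.+1).
Qed.

Lemma prefix_of_common (T : eqType) (s t u : seq T) :
  prefix s u -> prefix t u -> size s <= size t -> prefix s t.
Proof.
rewrite !prefixE => /eqP su /eqP tu le_st; apply/eqP.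
by rewrite -tu take_takel.
Qed.

(** [B] is a common part of all vertices, later the code word, and [D] holds the position blocks.
    The entries of an ordered subset are distinct, so [#|Y|] blocks suffice. *)
Lemma shrub_in (T : finType) (r : nat) (Y B D : {set T}) :
  #|T| <= 2 ^ r -> #|Y| * (2 * r) <= #|D| ->
  [disjoint Y & B] -> [disjoint Y & D] -> [disjoint B & D] ->
  exists tau : seq T -> {set T}, forall s, ordered_subset Y s ->
    [/\ B \subset tau s, tau s \subset Y :|: B :|: D, tau s :&: Y = [set x in s]
      & forall t, ordered_subset Y t -> (tau s \subset tau t) = prefix s t].
Proof.
move=> leT leD YB YD BD; have [E E_inj] := antichain_code leT.
have [|g g_inj gD] := @inj_into_set ('I_#|Y| * ('I_r * bool))%type T D.
  by rewrite !card_prod !card_ord card_bool [r * 2]mulnC.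
pose blocks (s : seq T) : {set T} :=
  g @: [set z : 'I_#|Y| * ('I_r * bool) |
    [exists x : T, (onth s z.1 == Some x) && (z.2 \in E x)]].
have sub_blocks s : blocks s \subset D by apply/subsetP => _ /imsetP[z _ ->].
have gY z : g z \notin Y by rewrite (disjointFl YD).
have gB z : g z \notin B by rewrite (disjointFl BD).
exists (fun s => [set x in s] :|: B :|: blocks s) => s /andP[s_uniq /allP sY].
have sub_s : [set x in s] \subset Y by apply/subsetP => x; rewrite inE => /sY.
have trace u : ordered_subset Y u ->
    ([set x in u] :|: B :|: blocks u) :&: Y = [set x in u].
  move=> /andP[_ /allP uY]; apply/setP => x; rewrite !inE.
  have [xY|xY] := boolP (x \in Y); last first.
    by rewrite andbF; apply/esym/negP => /uY; apply/negP.
  rewrite (disjointFr YB xY) orbF andbT.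
  have /negPf -> : x \notin blocks u; last by rewrite orbF.
  by apply/negP => /(subsetP (sub_blocks u)); rewrite (disjointFr YD xY).
split.
- by rewrite -setUA setUCA subsetUl.
- by rewrite setUSS // setSU.
- by apply: trace; rewrite /ordered_subset s_uniq; apply/allP.
move=> t /[dup] t_ord /andP[t_uniq /allP tY]; apply/idP/idP => [sub_st|]; last first.
  case/prefixP => s' ->; rewrite setUSS ?setSU //.
    by apply/subsetP => x; rewrite !inE mem_cat => ->.
  apply/imsetS/subsetP => z; rewrite !inE => /existsP[x /andP[/eqP sx xz]].
  apply/existsP; exists x; rewrite xz andbT onth_cat.
  by rewrite ifT ?sx // -onthTE sx.
have s_ord : ordered_subset Y s by rewrite /ordered_subset s_uniq; apply/allP.
have sub_s_t : {subset s <= t}.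
  move=> x xs; have : x \in [set x in t].
    by rewrite -(trace t) //; apply: subsetP (setSI Y sub_st) _ _; rewrite trace // inE.
  by rewrite inE.
(* Since [t] is at least as long as [s], each position occupied in [s] is occupied in [t], and block
   [i] then forces equal entries by the antichain property of [E]. *)
have le_st := uniq_leq_size s_uniq sub_s_t.
have le_sY : size s <= #|Y|.
  by rewrite -(card_uniqP s_uniq) -[#|s|]cardsE subset_leq_card.
apply: prefix_of_onth => i x sx.
have lt_is : i < size s by rewrite -onthTE sx.
have : onth t i by rewrite onthTE (leq_trans lt_is).
case tx : (onth t i) => [y|//] _; congr Some; apply/esym/E_inj/subsetP => u xu.
pose z := (Ordinal (leq_trans lt_is le_sY), u).
have zs : g z \in blocks s.
  by rewrite imset_f // inE; apply/existsP; exists x; rewrite sx eqxx.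
have := subsetP sub_st (g z); rewrite !inE zs orbT => /(_ isT).
rewrite (negPf (gB z)) orbF => /orP[/tY|]; first by rewrite (negPf (gY z)).
case/imsetP=> z' + /g_inj zE; rewrite -zE inE => /existsP[y'].
by rewrite tx => /andP[/eqP[<-]].
Qed.

(** * The numerical estimate *)

(** With the crude bound [ln 2 >= 1/2] the leading term is about [16 * k * ln N], that is
    [160/216 * N]; the remaining [56/216 * N] absorbs the lower-order terms. *)
Lemma room_estimate (R : realType) (N k : nat) : 2 ^ 20 <= N ->
  is_rounding (10 / 216 * (N%:R / ln (N%:R : R)))%R k ->
  (4 * k).+1 * (2 * up_log 2 N) + k <= N.
Proof.
move=> leN; rewrite /is_rounding; set x : R := N%:R%R; set L := ln x.
have N_gt1 : 1 < N by apply: leq_trans leN; rewrite (ltn_exp2l 0).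
have /andP[ltr _] := up_log_bounds (isT : 1 < 2) N_gt1.
have r_gt0 : 0 < up_log 2 N by rewrite up_log_gt0.
(* From here on [r] is the predecessor of [up_log 2 N], so [2 ^ r < N]. *)
move: (up_log 2 N) r_gt0 ltr => [//|r] _ /= ltr.
have lex : (1024 * 1024 <= x :> R)%R.
  have := leN; rewrite -(ler_nat R) natrX (exprD _ 10 10) -/x; apply: le_trans; lra.
have ln2 : (1 / 2 <= ln 2 :> R)%R.
  have := @le_ln1Dx R (- (1 / 2))%R ltac:(lra).
  have -> : (1 + - (1 / 2) = 2^-1 :> R)%R by lra.
  by rewrite lnV ?posrE //; lra.
have ln_pow n : 2 ^ n <= N -> (n%:R <= 2 * L :> R)%R.
  move=> len; have : (ln (2 ^+ n) <= L :> R)%R.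
    by rewrite ler_ln ?posrE ?exprn_gt0 // -?natrX ?ler_nat // ltr0n (ltnW N_gt1).
  rewrite lnXn // -[(_ *+ n)%R]mulr_natr => leL.
  have : (0 <= n%:R :> R)%R by rewrite ler0n.
  by move/(ler_wpM2r)/(_ _ _ ln2); lra.
have L10 : (10 <= L)%R by have := ln_pow _ leN; lra.
clear leN.
have rL := ln_pow _ (ltnW ltr).
(* Apply [ln y <= y - 1] to both factors of [x = 400 * (x / 400)]. *)
have Lx : (20 * L <= x / 20 + 8000)%R.
  have xE : x = (400 * (x / 400))%R by lra.
  have := @le_ln1Dx R (x / 400 - 1)%R ltac:(lra).
  have := @le_ln1Dx R (400 - 1)%R ltac:(lra).
  rewrite ![(1 + _)%R]addrC !subrK => h1 h2.
  have : L = (ln 400 + ln (x / 400))%R by rewrite -lnM ?posrE -?xE //; lra.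
  lra.
rewrite ltr_norml => /andP[_ kx].
set q := (x / L)%R in kx.
have qE : (q * L = x)%R by rewrite /q divfK //; lra.
have q_x : (10 * q <= x)%R by nra.
have k0 : (0 <= k%:R :> R)%R by rewrite ler0n.
have r0 : (0 <= r%:R :> R)%R by rewrite ler0n.
rewrite -(ler_nat R) natrD 2!natrM -[((4 * k).+1%:R)%R]natr1 -[(r.+1%:R)%R]natr1.
rewrite natrM -/x.
have kL : (k%:R * (2 * L + 1) <= (10 / 216 * q + 1) * (2 * L + 1))%R.
  by apply: ler_wpM2r; lra.
have krL : (k%:R * (r%:R + 1) <= k%:R * (2 * L + 1))%R.
  by apply: ler_wpM2l; lra.
lra.
Qed.

(** * All shrubs together, and the coloring *)

(** The code area takes [(3 * k).+1 * (2 * r)] elements, the blocks [k * (2 * r)], and [Y] itself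
    [k]; this is the required room. *)
Lemma incomparable_shrubs (T : finType) (k r : nat) :
  #|T| <= 2 ^ r -> 0 < r -> (4 * k).+1 * (2 * r) + k <= #|T| ->
  exists tau : {set T} -> seq T -> {set T},
    forall (Y : {set T}) s, #|Y| = k -> ordered_subset Y s ->
      tau Y s :&: Y = [set x in s] /\
      forall (Y' : {set T}) t, #|Y'| = k -> ordered_subset Y' t ->
        (tau Y s \subset tau Y' t) = (Y == Y') && prefix s t.
Proof.
move=> leT r_gt0 room; pose n := (3 * k).+1 * (2 * r).
have [|h h_inj _] := @inj_into_set 'I_n T setT.
  by rewrite cardsT card_ord /n; nia.
pose A := h @: setT; have cardA : #|A| = n by rewrite card_imset // cardsT card_ord.
have lt_k : 3 * k < 2 ^ r by apply: leq_trans leT; nia.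
have [|f [fA f_sep]] := subset_code_in leT r_gt0 lt_k (_ : n <= #|A|).
  by rewrite cardA.
have shrubY (Y : {set T}) : exists tau : seq T -> {set T}, #|Y| = k ->
    forall s, ordered_subset Y s ->
      [/\ f Y :\: Y \subset tau s,
          tau s \subset Y :|: (f Y :\: Y) :|: ~: (A :|: Y),
          tau s :&: Y = [set x in s]
        & forall t, ordered_subset Y t -> (tau s \subset tau t) = prefix s t].
  have [cY|neq] := eqVneq #|Y| k; last by exists (fun=> set0) => /eqP; rewrite (negPf neq).
  have [||||tau tauP] := @shrub_in T r Y (f Y :\: Y) (~: (A :|: Y)) leT.
  - have := cardsC (A :|: Y); have := leq_card_setU A Y.
    by move/leq_of_leqif; rewrite cardA cY /n; nia.
  - by rewrite -setI_eq0 setIDA setDIl setDv set0I.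
  - by rewrite disjoints_subset setCK subsetUr.
  - by rewrite disjoints_subset setCK (subset_trans (subsetDl _ _)) // subsetU ?fA.
  by exists tau.
have [tau tauP] := choice shrubY; exists tau => Y s cY sY.
have [sub_s _ trace_s pre_s] := tauP Y cY s sY; split=> // Y' t cY'.
have [<-|neqY tY'] /= := eqVneq Y Y'; first exact: pre_s.
have [_ sub_t _ _] := tauP Y' cY' t tY'.
(* Inside [A], the vertex of [Y'] contains only elements of [f Y'] and [Y'], so an inclusion would
   put [f Y] into [f Y' :|: Y :|: Y']. *)
apply: contraNF (f_sep Y Y' cY cY' neqY) => sub_st; apply/subsetP => x xf.
have := subsetP (subset_trans sub_s (subset_trans sub_st sub_t)) x.
rewrite !inE xf (subsetP (fA Y) _ xf) orbF /= andbT.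
case: (x \in Y) => [_|/(_ isT)]; first by rewrite orbT.
by case: (x \in Y'); rewrite ?orbT //= => ->.
Qed.

Theorem theorem18 (R : realType) :
  exists N0 : nat, forall N k : nat,
    (N0 <= N)%N ->
    is_rounding (10 / 216 * (N%:R / ln (N%:R : R)))%R k ->
    exists c : {set 'I_N} -> color,
      ~ (exists F : {set {set 'I_N}}, Lambda_copy F /\ all_blue c F) /\
      (forall Y : {set 'I_N}, #|Y| = k ->
        exists F : {set {set 'I_N}}, shrub Y F /\ all_blue c F).
Proof.
exists (2 ^ 20) => N k leN /(room_estimate leN) room.
have N_gt1 : 1 < N by apply: leq_trans leN; rewrite (ltn_exp2l 0).
have [|||tau tauP] := @incomparable_shrubs 'I_N k (up_log 2 N).
- by rewrite card_ord up_logP.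
- by rewrite up_log_gt0.
- by rewrite card_ord.
pose blue (A : {set 'I_N}) :=
  exists (Y : {set 'I_N}) s, [/\ #|Y| = k, ordered_subset Y s & tau Y s = A].
pose c A := if `[< blue A >] then Blue else Red.
have c_blue A : c A = Blue -> blue A by rewrite /c; case: asboolP.
exists c; split=> [[F [[f [[_ f_mono] F_im]] F_blue]]|Y cY].
  have f_blue i : blue (f i) by apply/c_blue/F_blue/F_im; exists i.
  have [Y0 [s0 [c0 o0 e0]]] := f_blue (inord 0).
  have [Y1 [s1 [c1 o1 e1]]] := f_blue (inord 1).
  have [Y2 [s2 [c2 o2 e2]]] := f_blue ord_max.
  have [_ le0] := tauP _ _ c0 o0; have [_ le1] := tauP _ _ c1 o1.
  have : f (inord 0) \subset f ord_max by rewrite f_mono /Lambda_le eqxx orbT.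
  rewrite -e0 -e2 le0 // => /andP[/eqP eY0 p02].
  have : f (inord 1) \subset f ord_max by rewrite f_mono /Lambda_le eqxx orbT.
  rewrite -e1 -e2 le1 // => /andP[/eqP eY1 p12]; subst Y0 Y1.
  have := f_mono (inord 0) (inord 1); have := f_mono (inord 1) (inord 0).
  rewrite -e0 -e1 le0 // le1 // eqxx /Lambda_le -!val_eqE /= !inordK //=.
  (* Two prefixes of [s2] are comparable, whereas the two minimal elements of the copy are not. *)
  case/orP: (leq_total (size s0) (size s1)) => le_s.
    by rewrite (prefix_of_common p02 p12).
  by rewrite (prefix_of_common p12 p02).
have tau_mono : {mono (fun S : factorial_tree Y => tau Y (sval S)) :
    S S' / prefix_le S S' >-> S \subset S'}.
  by move=> [s sY] [t tY] /=; have [_ ->] := tauP _ _ cY sY; rewrite ?eqxx.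
exists [set A | `[< exists S : factorial_tree Y, tau Y (sval S) = A >]].
split; last first.
  move=> A; rewrite inE => /asboolP[[s sY] <-]; rewrite /c.
  by case: asboolP => // -[]; exists Y, s.
exists (fun S => tau Y (sval S)); split.
- split=> // S S' eqS; apply/val_inj; have := tau_mono S S'; have := tau_mono S' S.
  rewrite /= eqS subxx => /esym le_S'S /esym le_SS'.
  have:= le_SS'; rewrite /prefix_le prefixE take_oversize ?(size_prefix le_S'S) //.
  by move/eqP.
- by move=> [s sY]; have [-> _] := tauP _ _ cY sY.
- by move=> A; rewrite inE; split=> [/asboolP|] // ?; apply/asboolP.
Qed.
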